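(* Let $X$ be a pointed metric space and $E$ a Banach space over $\mathbb{K}$. The map $K\colon X^\#\circledast_{\pi'} E^*\to\mathrm{Lip}_{0F}(X,E^* )$, defined by $$K\left(\sum_{j=1}^m g_j\boxtimes\phi_j\right)=\sum_{j=1}^m g_j\cdot\phi_j ,$$ is an isometric isomorphism, where $\mathrm{Lip}_{0F}(X,E^* )$ carries the norm $\mathrm{Lip}$. As a consequence, the space of all Lipschitz approximable operators from $X$ to $E^*$ (with the norm $\mathrm{Lip}$) is isometrically isomorphic to $X^\#\widehat{\circledast}_{\pi'} E^*$.
   Context: $\mathbb{K}$ is $\mathbb{R}$ or $\mathbb{C}$. A pointed metric space $X$ is a metric space (with metric $d$) with a distinguished base point $0$. For a pointed metric space $X$ and a Banach space $F$, $\mathrm{Lip}_0(X,F)$ is the Banach space of all Lipschitz maps $f\colon X\to F$ with $f(0)=0$, normed by the least Lipschitz constant $\mathrm{Lip}(f)$; $X^\#=\mathrm{Lip}_0(X,\mathbb{K})$. $E^*$ is the topological dual of $E$ and $\langle\phi,e\rangle=\phi(e)$; $V'$ denotes the algebraic dual of a vector space $V$. For $x,y\in X$ and $e\in E$, $\delta_{(x,y)}\boxtimes e\in \mathrm{Lip}_0(X,E^* )'$ is the linear functional $f\mapsto\langle f(x)-f(y),e\rangle$. The Lipschitz tensor product $X\boxtimes E$ is the linear subspace of $\mathrm{Lip}_0(X,E^* )'$ spanned by all the functionals $\delta_{(x,y)}\boxtimes e$ with $x,y\in X$, $e\in E$. Every $u\in X\boxtimes E$ can be written (non-uniquely) as $u=\sum_{i=1}^n\delta_{(x_i,y_i)}\boxtimes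 e_i$. The Lipschitz projective norm on $X\boxtimes E$ is $\pi(u)=\inf\left\{\sum_{i=1}^n d(x_i,y_i)\|e_i\|\colon u=\sum_{i=1}^n\delta_{(x_i,y_i)}\boxtimes e_i\right\}$, the infimum being over all representations of $u$. For $g\in X^\#$ and $\phi\in E^*$, $g\boxtimes\phi\in(X\boxtimes E)'$ is the (well-defined) linear functional $(g\boxtimes\phi)\left(\sum_{i=1}^n \delta_{(x_i,y_i)}\boxtimes e_i\right)=\sum_{i=1}^n(g(x_i)-g(y_i))\langle\phi,e_i\rangle$. The space $X^\#\circledast E^*$ is the linear subspace of $(X\boxtimes E)'$ spanned by $\{g\boxtimes\phi\colon g\in X^\#,\ \phi\in E^*\}$. The norm $\pi'$ on $X^\#\circledast E^*$ is the restriction of the dual norm of $(X\boxtimes E,\pi)^*$: $\pi'(u^* )=\sup\{|u^*(u)|\colon u\in X\boxtimes E,\ \pi(u)\leq 1\}$. $X^\#\circledast_{\pi'}E^*$ is $X^\#\circledast E^*$ with the norm $\pi'$, and $X^\#\widehat{\circledast}_{\pi'}E^*$ is its completion. For $g\in X^\#$, $\phi\in E^*$, $g\cdot\phi\in\mathrm{Lip}_0(X,E^* )$ is the map $(g\cdot\phi)(x)=g(x)\phi$. $\mathrm{Lip}_{0F}(X,E^* )$ is the linear subspace of those $f\in\mathrm{Lip}_0(X,E^* )$ for which the linear span of $f(X)$ is finite-dimensional (Lipschitz finite-rank operators). $f\in\mathrm{Lip}_0(X,E^* )$ is Lipschitz approximable if it is the limit in the norm $\mathrm{Lip}$ of a sequence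 of Lipschitz finite-rank operators from $X$ to $E^*$. *)

(* Defs.v *)
From HB Require Import structures.
From mathcomp Require Import all_boot all_order all_algebra.
From mathcomp Require Import all_classical all_reals all_analysis.
From mathcomp Require Import complex.
Import Order.TTheory GRing.Theory Num.Theory.
Import numFieldNormedType.Exports.

Set Implicit Arguments.
Unset Strict Implicit.
Unset Printing Implicit Defensive.

Local Open Scope classical_set_scope.
Local Open Scope ring_scope.

Variant base_field := real_base | complex_base.

Definition scalars (R : realType) (b : base_field) : numFieldType :=
  match b with real_base => R | complex_base => R[i] end.

Definition of_real (R : realType) (b : base_field) : R -> scalars R b :=
  match b with real_base => id | complex_base => fun r => r%:C%C end.

Definition real_part (R : realType) (b : base_field) : scalars R b -> R :=
  match b with real_base => id | complex_base => @complex.Re R end.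

(* The library's norms take values in the scalar field; nrm is the same norm
   seen as a real number, see nrmK. *)
Definition nrm (R : realType) (b : base_field)
  (V : normedModType (scalars R b)) (v : V) : R := @real_part R b `|v|.

Section ScalarTheory.
Context {R : realType} {b : base_field}.
Local Notation K := (scalars R b).
Local Notation re := (@real_part R b).
Local Notation ofr := (@of_real R b).

Lemma real_partD (x y : K) : re (x + y) = re x + re y.
Proof. by case: b x y => //= -[a c] [a' c']. Qed.

Lemma of_realD (x y : R) : ofr (x + y) = ofr x + ofr y.
Proof. by case: b => //=; rewrite rmorphD. Qed.

Lemma of_realM (x y : R) : ofr (x * y) = ofr x * ofr y.
Proof. by case: b => //=; rewrite rmorphM. Qed.

Lemma of_real0 : ofr 0 = 0.
Proof. by case: b. Qed.

Lemma of_realK (x : R) : re (ofr x) = x.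
Proof. by case: b. Qed.

Lemma real_partK (x : K) : 0 <= x -> ofr (re x) = x.
Proof. by case: b x => //= -[a c]; rewrite lecE /= => /andP[/eqP -> _]. Qed.

Lemma ler_of_real (x y : R) : (ofr x <= ofr y) = (x <= y).
Proof. by case: b => //=; rewrite lecR. Qed.

Lemma ler_re (x y : K) : x <= y -> re x <= re y.
Proof. by case: b x y => //= -[a c] [a' c']; rewrite lecE => /andP[]. Qed.

Section Norm.
Context {V : normedModType K}.
Implicit Types v w : V.

Lemma nrmK v : ofr (nrm v) = `|v|.
Proof. by rewrite /nrm real_partK. Qed.

Lemma nrm_ge0 v : 0 <= nrm v.
Proof. by rewrite -ler_of_real nrmK of_real0. Qed.

Lemma nrm0 : nrm (0 : V) = 0.
Proof. by rewrite /nrm normr0 -of_real0 of_realK. Qed.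

Lemma nrm_eq0 v : nrm v = 0 -> v = 0.
Proof. by move=> v0; apply: normr0_eq0; rewrite -nrmK v0 of_real0. Qed.

Lemma nrmD v w : nrm (v + w) <= nrm v + nrm w.
Proof. by rewrite -ler_of_real of_realD !nrmK ler_normD. Qed.

Lemma nrmN v : nrm (- v) = nrm v.
Proof. by rewrite /nrm normrN. Qed.

Lemma nrm_sum (I : Type) (r : seq I) (F : I -> V) :
  nrm (\sum_(i <- r) F i) <= \sum_(i <- r) nrm (F i).
Proof.
elim: r => [|i r IH]; first by rewrite !big_nil nrm0.
by rewrite !big_cons (le_trans (nrmD _ _))// lerD2l.
Qed.

End Norm.

Lemma nrmZ (V : normedModType K) (a : K) (v : V) : nrm (a *: v) = nrm (a : K^o) * nrm v.
Proof.
apply: (can_inj of_realK); rewrite of_realM !nrmK normrZ.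
by congr (_ * _); exact: (esym (nrmK (a : K^o))).
Qed.

Lemma nrm_of_real (r : R) : 0 <= r -> nrm (ofr r : K^o) = r.
Proof.
by move=> r0; rewrite /nrm ger0_norm ?of_realK// -of_real0 ler_of_real.
Qed.

End ScalarTheory.

Definition lspan (K : pzRingType) (V : lmodType K) (A : set V) : set V :=
  [set v | exists n (a : 'I_n -> K) (w : 'I_n -> V),
     (forall i, A (w i)) /\ v = \sum_(i < n) a i *: w i].

Definition finite_dimensional (K : pzRingType) (V : lmodType K) (W : set V) :=
  exists n (w : 'I_n -> V), W = lspan (range w).

Section SpanTheory.
Context {K : fieldType} {V : lmodType K}.
Implicit Types A W : set V.

Lemma lspan_sub A : A `<=` lspan A.
Proof.
move=> v Av; exists 1%N, (fun=> 1), (fun=> v); split=> //.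
by rewrite big_ord1 scale1r.
Qed.

Lemma lspan0 A : lspan A 0.
Proof. by exists 0%N, (fun=> 0), (fun=> 0); split=> [[]//|]; rewrite big_ord0. Qed.

Lemma lspanP A (a : K) v w : lspan A v -> lspan A w -> lspan A (a *: v + w).
Proof.
move=> [n [c [x [Ax ->]]]] [m [d [y [Ay ->]]]].
exists (n + m)%N,
  (fun i : 'I_(n + m) => match fintype.split i with inl j => a * c j | inr j => d j end),
  (fun i : 'I_(n + m) => match fintype.split i with inl j => x j | inr j => y j end).
split; first by move=> i; case: (fintype.split i).
rewrite big_split_ord /= scaler_sumr; congr (_ + _); apply: eq_bigr => i _.
  by rewrite -[lshift m i]/(unsplit (inl i)) unsplitK scalerA.
by rewrite -[rshift n i]/(unsplit (inr i)) unsplitK.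
Qed.

Definition subspace_set W := W 0 /\ forall (a : K) v w, W v -> W w -> W (a *: v + w).

Lemma subspace_lspan A : subspace_set (lspan A).
Proof. by split; [exact: lspan0|move=> *; exact: lspanP]. Qed.

Lemma lspan_min A W : subspace_set W -> A `<=` W -> lspan A `<=` W.
Proof.
move=> [W0 WP] AW v [n [c [x [Ax ->]]]].
elim/big_ind: _ => // [u w Wu Ww|i _]; first by rewrite -[u]scale1r; exact: WP.
by rewrite -[_ *: _]addr0; apply: WP => //; exact/AW/Ax.
Qed.

Lemma lspan_mono A B : A `<=` B -> lspan A `<=` lspan B.
Proof.
move=> AB; apply: lspan_min; first exact: subspace_lspan.
exact/(subset_trans AB)/lspan_sub.
Qed.

(* A subspace of a finite-dimensional space is finite-dimensional. *)
Lemma finite_dimensional_sub n (w : 'I_n -> V) W :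
  subspace_set W -> W `<=` lspan (range w) -> finite_dimensional W.
Proof.
elim: n w W => [|n IH] w W sW Ww.
  exists 0%N, w; apply/seteqP; split=> //.
  by apply: lspan_min => // v [[]].
pose w' (i : 'I_n) := w (widen_ord (leqnSn n) i).
have wE v : lspan (range w) v -> exists a, lspan (range w') (v - a *: w ord_max).
  move=> [m [c [x [xw ->]]]].
  elim/big_ind: _ => [|u u' [a ua] [a' ua']|i _].
  - by exists 0; rewrite scale0r subr0; exact: lspan0.
  - exists (a + a'); rewrite scalerDl opprD addrACA.
    by rewrite -[X in X + _]scale1r; exact: lspanP.
  - have [k _ <-] := xw i.
    have [kn|kn] := ltnP k n.
      exists 0; rewrite scale0r subr0 -[_ *: _]addr0; apply: lspanP; last exact: lspan0.
      by apply: lspan_sub; exists (Ordinal kn) => //; congr w; exact: val_inj.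
    exists (c i); have -> : k = ord_max.
      by apply: val_inj; apply/eqP; rewrite eqn_leq kn -ltnS ltn_ord.
    by rewrite subrr; exact: lspan0.
pose W' := W `&` lspan (range w').
have sW' : subspace_set W'.
  split; first by split; [case: sW|exact: lspan0].
  move=> a u v [Wu wu] [Wv wv]; split; last exact: lspanP.
  by case: sW => _; exact.
have [m [z W'E]] := IH w' W' sW' (@subIsetr _ _ _).
have [WW'|/existsNP[u /not_implyP[Wu nwu]]] := pselect (W `<=` lspan (range w')).
  exists m, z; rewrite -W'E; apply/seteqP; split; last exact: subIsetl.
  by move=> v Wv; split=> //; exact: WW'.
have [a ua] := wE _ (Ww _ Wu).
have a0 : a != 0 by apply: contra_notN nwu => /eqP a0; move: ua; rewrite a0 scale0r subr0.
exists m.+1, (fun i => if unlift ord0 i is Some j then z j else u).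
apply/seteqP; split; last first.
  apply: lspan_min => // v [i _ <-]; case: unliftP => // j _.
  have [//] : W' (z j) by rewrite W'E; apply: lspan_sub; exists j.
move=> v Wv; have [c vc] := wE _ (Ww _ Wv).
have -> : v = (c / a) *: u + (v - (c / a) *: u) by rewrite addrC subrK.
apply: lspanP.
  by apply: lspan_sub; exists ord0 => //; rewrite unlift_none.
have : W' (v - (c / a) *: u).
  split.
    by rewrite addrC -scaleNr; case: sW => _; apply.
  have -> : v - (c / a) *: u
      = (- (c / a)) *: (u - a *: w ord_max) + (v - c *: w ord_max).
    by rewrite scalerBr !scaleNr opprK scalerA divfK// addrACA subrr addr0 addrC.
  exact: lspanP.
rewrite W'E; apply: lspan_mono => _ [i _ <-].
by exists (lift ord0 i) => //; rewrite liftK.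
Qed.

End SpanTheory.

Section NormTools.
Context {R : realType} {b : base_field}.
Local Notation K := (scalars R b).

Definition sup_norm_on (T : Type) (B : set T) (h : T -> K^o) : R :=
  sup [set nrm (h t) | t in B].

Section SupNorm.
Context {T : Type} {B : set T} {t0 : T} (Bt0 : B t0).
Implicit Types h : T -> K^o.

Let bounded_on h := exists M, forall t, B t -> nrm (h t) <= M.

Lemma sup_norm_on_ub h t : bounded_on h -> B t -> nrm (h t) <= sup_norm_on B h.
Proof.
move=> [M hM] Bt; apply: ub_le_sup; last by exists t.
by exists M => _ [u Bu <-]; exact: hM.
Qed.

Lemma sup_norm_on_le h M : (forall t, B t -> nrm (h t) <= M) ->
  sup_norm_on B h <= M.
Proof.
move=> hM; apply: ge_sup; first by exists (nrm (h t0)), t0.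
by move=> _ [u Bu <-]; exact: hM.
Qed.

Lemma sup_norm_on_ge0 h : bounded_on h -> 0 <= sup_norm_on B h.
Proof. by move=> /sup_norm_on_ub /(_ Bt0); apply: le_trans; exact: nrm_ge0. Qed.

Lemma sup_norm_onD h k : bounded_on h -> bounded_on k ->
  sup_norm_on B (h + k) <= sup_norm_on B h + sup_norm_on B k.
Proof.
move=> bh bk; apply: sup_norm_on_le => t Bt.
by rewrite (le_trans (nrmD _ _))// lerD// sup_norm_on_ub.
Qed.

Lemma sup_norm_onZ_le h (a : K) : bounded_on h ->
  sup_norm_on B (a *: h) <= nrm (a : K^o) * sup_norm_on B h.
Proof.
move=> bh; apply: sup_norm_on_le => t Bt.
by rewrite nrmZ ler_wpM2l ?nrm_ge0// sup_norm_on_ub.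
Qed.

End SupNorm.

Lemma seminormZ (V : lmodType K) (N : V -> R) : (forall v, 0 <= N v) ->
  (forall (a : K) v, N (a *: v) <= nrm (a : K^o) * N v) ->
  forall (a : K) v, N (a *: v) = nrm (a : K^o) * N v.
Proof.
move=> N0 NZ a v; apply/eqP; rewrite eq_le NZ/=.
have [->|a0] := eqVneq a 0; first by rewrite nrm0 mul0r.
have an0 : 0 < nrm (a : K^o).
  by rewrite lt_neqAle nrm_ge0 andbT eq_sym; apply: contra a0 => /eqP/nrm_eq0 ->.
have nV : nrm (a^-1 : K^o) = (nrm (a : K^o))^-1.
  apply: (mulfI (lt0r_neq0 an0)); rewrite mulfV ?lt0r_neq0//.
  rewrite -(@nrmZ _ _ K^o a (a^-1 : K^o)) /GRing.scale/= mulfV//.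
  by rewrite /nrm normr1; case: (b).
rewrite -ler_pdivlMl// -nV (le_trans _ (NZ _ _))//.
by rewrite scalerA mulVf// scale1r.
Qed.

Section ScalarNorm.
Context {V : lmodType K} {N : V -> R}.

Definition scalar_norm (v : V) : K := of_real b (N v).

Lemma scalar_normD : (forall v w, N (v + w) <= N v + N w) ->
  forall v w, scalar_norm (v + w) <= scalar_norm v + scalar_norm w.
Proof. by move=> ND v w; rewrite -of_realD ler_of_real. Qed.

Lemma scalar_normZ : (forall (a : K) v, N (a *: v) = nrm (a : K^o) * N v) ->
  forall (a : K) v, scalar_norm (a *: v) = `|a| * scalar_norm v.
Proof. by move=> NZ a v; rewrite /scalar_norm NZ of_realM (nrmK (a : K^o)). Qed.

Lemma scalar_norm_eq0 : (forall v, N v = 0 -> v = 0) ->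
  forall v, scalar_norm v = 0 -> v = 0.
Proof.
move=> N0 v v0; apply: N0.
by rewrite -[LHS](@of_realK R b) -/(scalar_norm v) v0 -(@of_real0 R b) of_realK.
Qed.

End ScalarNorm.

End NormTools.

Section Dual.
Context {R : realType} {b : base_field}.
Local Notation K := (scalars R b).
Variable E : normedModType K.

Definition dual_pred : {pred E -> K^o} :=
  fun phi => `[< linear phi /\ continuous phi >].

Record dual := Dual { dual_fun :> E -> K^o; _ : dual_fun \in dual_pred }.

HB.instance Definition _ := [isSub for dual_fun].
HB.instance Definition _ := [Choice of dual by <:].

Fact dual_submod_closed : submod_closed dual_pred.
Proof.
split.
  apply/asboolP; split; first by move=> a x y; rewrite scaler0 addr0.
  exact: cst_continuous.
move=> a phi psi /asboolP[lphi cphi] /asboolP[lpsi cpsi]; apply/asboolP; split.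
  move=> c x y; rewrite !fctE lphi lpsi !scalerDr !scalerA (mulrC a).
  by rewrite addrACA.
move=> x; apply: cvgD; last exact: cpsi.
by apply: cvgZr; exact: cphi.
Qed.

HB.instance Definition _ :=
  GRing.isSubmodClosed.Build K (E -> K^o) dual_pred dual_submod_closed.
HB.instance Definition _ := [SubChoice_isSubLmodule of dual by <:].

Lemma dual_linear (phi : dual) : linear phi.
Proof. by case: phi => phi /= /asboolP[]. Qed.

Lemma dual_continuous (phi : dual) : continuous phi.
Proof. by case: phi => phi /= /asboolP[]. Qed.

HB.instance Definition _ (phi : dual) :=
  GRing.isLinear.Build K E K^o *:%R (dual_fun phi) (dual_linear phi).

Definition dual_norm (phi : dual) : R :=
  sup_norm_on [set e : E | nrm e <= 1] phi.

Lemma dual_bounded (phi : dual) :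
  exists M, 0 <= M /\ forall e, nrm (phi e) <= M * nrm e.
Proof.
have [_ /(_ (@dual_continuous phi))/linear_boundedP] :=
  linear_bounded_continuous (phi : {linear E -> K^o}).
move=> /pinfty_ex_gt0[M M0 phiM]; exists (@real_part R b M).
have M0' : 0 <= real_part M.
  by rewrite -(@ler_of_real R b) of_real0 real_partK ltW.
split=> // e; rewrite -(@ler_of_real R b) of_realM !nrmK real_partK ?(ltW M0)//.
exact: phiM.
Qed.

Let ball0 : [set e : E | nrm e <= 1] 0.
Proof. by rewrite /= nrm0. Qed.

Lemma dual_bounded_ball (phi : dual) :
  exists M, forall e, [set e : E | nrm e <= 1] e -> nrm (phi e) <= M.
Proof.
have [M [M0 phiM]] := dual_bounded phi; exists M => e /= e1.
by rewrite (le_trans (phiM e))// -[leRHS]mulr1 ler_wpM2l.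
Qed.

Lemma dual_norm_ge0 phi : 0 <= dual_norm phi.
Proof. exact/(sup_norm_on_ge0 ball0)/dual_bounded_ball. Qed.

Lemma dual_norm_le (phi : dual) e : nrm (phi e) <= dual_norm phi * nrm e.
Proof.
have [e0|e0] := eqVneq (nrm e) 0.
  by rewrite (nrm_eq0 e0) linear0 !nrm0 mulr0.
have en : 0 < nrm e by rewrite lt_neqAle eq_sym e0 nrm_ge0.
have nV : nrm (of_real b (nrm e)^-1 : K^o) = (nrm e)^-1.
  by rewrite nrm_of_real// invr_ge0 ltW.
rewrite -ler_pdivrMr// mulrC -nV -nrmZ -linearZ.
apply: sup_norm_on_ub; first exact: dual_bounded_ball.
by rewrite /= nrmZ nV mulVf.
Qed.

Lemma dual_normD phi psi : dual_norm (phi + psi) <= dual_norm phi + dual_norm psi.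
Proof. by apply: (sup_norm_onD ball0); exact: dual_bounded_ball. Qed.

Lemma dual_normZ (a : K) phi : dual_norm (a *: phi) = nrm (a : K^o) * dual_norm phi.
Proof.
apply: seminormZ; first exact: dual_norm_ge0.
by move=> c psi; apply: (sup_norm_onZ_le ball0); exact: dual_bounded_ball.
Qed.

Lemma dual_norm_eq0 phi : dual_norm phi = 0 -> phi = 0.
Proof.
move=> phi0; apply: val_inj; apply/funext => e; apply: nrm_eq0.
by apply/eqP; rewrite eq_le nrm_ge0 andbT (le_trans (dual_norm_le _ _))// phi0 mul0r.
Qed.

HB.instance Definition _ := Lmodule_isNormed.Build K dual
  (scalar_normD dual_normD) (scalar_normZ dual_normZ)
  (scalar_norm_eq0 dual_norm_eq0).

Lemma nrm_dual (phi : dual) : nrm phi = dual_norm phi.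
Proof. exact: of_realK. Qed.

End Dual.

Section Lip0.
Context {R : realType} {b : base_field}.
Local Notation K := (scalars R b).
Context {X : metricType R}.
Variables (x0 : X) (F : normedModType K).

Definition lipschitz_with (L : R) (f : X -> F) :=
  forall x y, nrm (f x - f y) <= L * mdist x y.

Definition Lip0_pred : {pred X -> F} :=
  fun f => `[< f x0 = 0 /\ exists L, lipschitz_with L f >].

Record Lip0 := MkLip0 { Lip0_fun :> X -> F; _ : Lip0_fun \in Lip0_pred }.

HB.instance Definition _ := [isSub for Lip0_fun].
HB.instance Definition _ := [Choice of Lip0 by <:].

Lemma lipschitz_withP (a : K) f g L M : lipschitz_with L f -> lipschitz_with M g ->
  lipschitz_with (nrm (a : K^o) * L + M) (a *: f + g).
Proof.
move=> fL gM x y; rewrite !fctE opprD addrACA -scalerBr (le_trans (nrmD _ _))//.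
by rewrite mulrDl lerD// nrmZ -mulrA ler_wpM2l ?nrm_ge0.
Qed.

Fact Lip0_submod_closed : submod_closed Lip0_pred.
Proof.
split.
  apply/asboolP; split=> //; exists 0 => x y.
  by rewrite [0 x - _]subrr nrm0 mul0r.
move=> a f g /asboolP[f0 [L fL]] /asboolP[g0 [M gM]]; apply/asboolP; split.
  by rewrite !fctE f0 g0 scaler0 addr0.
by eexists; exact: lipschitz_withP fL gM.
Qed.

HB.instance Definition _ :=
  GRing.isSubmodClosed.Build K (X -> F) Lip0_pred Lip0_submod_closed.
HB.instance Definition _ := [SubChoice_isSubLmodule of Lip0 by <:].

Lemma Lip0_base (f : Lip0) : f x0 = 0.
Proof. by case: f => f /= /asboolP[]. Qed.

(* The least Lipschitz constant; the constraint 0 <= L only matters when X is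
   reduced to its base point. *)
Definition Lip (f : Lip0) : R := inf [set L | 0 <= L /\ lipschitz_with L f].

Let Lip_set_ge0 (f : Lip0) : lbound [set L | 0 <= L /\ lipschitz_with L f] 0.
Proof. by move=> L []. Qed.

Let Lip_set_neq0 (f : Lip0) : [set L | 0 <= L /\ lipschitz_with L f] !=set0.
Proof.
case: f => f /= /asboolP[_ [L fL]]; exists `|L|; split=> // x y.
by rewrite (le_trans (fL x y))// ler_wpM2r ?mdist_ge0// ler_norm.
Qed.

Lemma Lip_ge0 f : 0 <= Lip f.
Proof. exact: lb_le_inf. Qed.

Lemma Lip_le (f : Lip0) L : 0 <= L -> lipschitz_with L f -> Lip f <= L.
Proof. by move=> L0 fL; apply: ge_inf => //; exists 0. Qed.

Lemma LipP (f : Lip0) : lipschitz_with (Lip f) f.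
Proof.
move=> x y; have [xy|xy] := eqVneq (mdist x y) 0.
  case: (Lip_set_neq0 f) => L [_ /(_ x y)].
  by rewrite xy !mulr0.
have d0 : 0 < mdist x y by rewrite lt_neqAle eq_sym xy mdist_ge0.
rewrite -ler_pdivrMr//; apply: lb_le_inf => // L [_ fL].
by rewrite ler_pdivrMr.
Qed.

Lemma LipD f g : Lip (f + g) <= Lip f + Lip g.
Proof.
apply: Lip_le; first by rewrite addr_ge0 ?Lip_ge0.
move=> x y; rewrite /= !fctE opprD addrACA (le_trans (nrmD _ _))// mulrDl.
by rewrite lerD ?LipP.
Qed.

Lemma LipZ (a : K) f : Lip (a *: f) = nrm (a : K^o) * Lip f.
Proof.
apply: seminormZ; first exact: Lip_ge0.
move=> {a f} a f; apply: Lip_le; first by rewrite mulr_ge0 ?nrm_ge0 ?Lip_ge0.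
move=> x y; rewrite /= !fctE -scalerBr nrmZ -mulrA ler_wpM2l ?nrm_ge0//.
exact: LipP.
Qed.

Lemma Lip_eq0 f : Lip f = 0 -> f = 0.
Proof.
move=> f0; apply: val_inj; apply/funext => x; apply: nrm_eq0.
have := LipP f x x0; rewrite f0 mul0r Lip0_base subr0 => fx.
by apply/eqP; rewrite eq_le nrm_ge0 fx.
Qed.

HB.instance Definition _ := Lmodule_isNormed.Build K Lip0
  (scalar_normD LipD) (scalar_normZ LipZ) (scalar_norm_eq0 Lip_eq0).

Lemma nrm_Lip0 (f : Lip0) : nrm f = Lip f.
Proof. exact: of_realK. Qed.

End Lip0.

Lemma lspan_submod_closed (K : fieldType) (V : lmodType K) (A : set V) :
  submod_closed (fun v : V => `[< lspan A v >]).
Proof.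
split; first exact/asboolP/lspan0.
by move=> a v w /asboolP Av /asboolP Aw; apply/asboolP/lspanP.
Qed.

Section LipschitzTensor.
Context {R : realType} {b : base_field}.
Local Notation K := (scalars R b).
Context {X : metricType R}.
Variables (x0 : X) (E : normedModType K).

Definition delta_box (x y : X) (e : E) : Lip0 x0 (dual E) -> K^o :=
  fun f => (f x - f y) e.

(* The ambient spaces of all scalar functions contain the algebraic duals; the
   spans below consist of linear functionals. *)
Definition LipTensor_pred : {pred Lip0 x0 (dual E) -> K^o} :=
  fun u => `[< lspan [set delta_box t.1.1 t.1.2 t.2 | t in [set: X * X * E]] u >].

Record LipTensor :=
  MkLipTensor { LipTensor_fun :> Lip0 x0 (dual E) -> K^o;
                _ : LipTensor_fun \in LipTensor_pred }.

HB.instance Definition _ := [isSub for LipTensor_fun].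
HB.instance Definition _ := [Choice of LipTensor by <:].
HB.instance Definition _ := GRing.isSubmodClosed.Build K
  (Lip0 x0 (dual E) -> K^o) LipTensor_pred (@lspan_submod_closed _ _ _).
HB.instance Definition _ := [SubChoice_isSubLmodule of LipTensor by <:].

(* A finite family (x_i, y_i, e_i) is encoded as a sequence of triples. *)
Definition represents (s : seq (X * X * E)) (u : LipTensor) :=
  \val u = \sum_(t <- s) delta_box t.1.1 t.1.2 t.2.

Definition pi_norm (u : LipTensor) : R :=
  inf [set \sum_(t <- s) mdist t.1.1 t.1.2 * nrm t.2 | s in represents^~ u].

Lemma delta_boxZ (a : K) x y e : delta_box x y (a *: e) = a *: delta_box x y e.
Proof. by apply/funext => f; rewrite /delta_box linearZ. Qed.

Lemma represents_ex (u : LipTensor) : exists s, represents s u.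
Proof.
have /asboolP[n [a [w [wt uE]]]] := valP u.
pose t i := s2val (cid2 (wt i)).
exists [seq ((t i).1, a i *: (t i).2) | i <- index_enum 'I_n].
rewrite /represents uE big_map; apply: eq_bigr => i _.
by rewrite /= delta_boxZ (s2valP' (cid2 (wt i))).
Qed.

Lemma representsE s u f : represents s u ->
  u f = \sum_(t <- s) (f t.1.1 - f t.1.2) t.2.
Proof. by move=> su; rewrite -[LHS]/(\val u f) su fct_sumE. Qed.

Lemma representsZ (a : K) s u : represents s u ->
  represents [seq (t.1, a *: t.2) | t <- s] (a *: u).
Proof.
move=> su; rewrite /represents linearZ/= su big_map scaler_sumr.
by apply: eq_bigr => t _; rewrite delta_boxZ.
Qed.

Lemma LipTensor_linear (u : LipTensor) : linear u.
Proof.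
have [s su] := represents_ex u => a f g.
rewrite !(representsE _ su) scaler_sumr -big_split; apply: eq_bigr => t _ /=.
by rewrite !fctE /= opprD addrACA -scalerBr.
Qed.

(* The defining formula, on some representation of u; boxtimesE shows that every
   representation gives the same value. *)
Definition boxtimes (g : Lip0 x0 K^o) (phi : dual E) : LipTensor -> K^o :=
  fun u => \sum_(t <- xget [::] (represents^~ u)) (g t.1.1 - g t.1.2) * phi t.2.

Fact Lip0_dot_subproof (g : Lip0 x0 K^o) (phi : dual E) :
  (fun x => g x *: phi) \in @Lip0_pred R b X x0 (dual E).
Proof.
apply/asboolP; split; first by rewrite Lip0_base scale0r.
exists (Lip g * nrm phi) => x y; rewrite -scalerBl nrmZ mulrAC.
by rewrite ler_wpM2r ?nrm_ge0// LipP.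
Qed.

Definition Lip0_dot (g : Lip0 x0 K^o) (phi : dual E) : Lip0 x0 (dual E) :=
  MkLip0 (Lip0_dot_subproof g phi).

Lemma boxtimes_eval g phi u : boxtimes g phi u = u (Lip0_dot g phi).
Proof.
rewrite /boxtimes; case: xgetP => [s _ su|nu]; last first.
  by have [s su] := represents_ex u; case: (nu s).
rewrite (representsE _ su); apply: eq_bigr => t _.
by rewrite /= -scalerBl.
Qed.

Lemma boxtimesE g phi s u : represents s u ->
  boxtimes g phi u = \sum_(t <- s) (g t.1.1 - g t.1.2) * phi t.2.
Proof.
move=> su; rewrite boxtimes_eval (representsE _ su); apply: eq_bigr => t _.
by rewrite /= -scalerBl.
Qed.

Definition circledast_pred : {pred LipTensor -> K^o} :=
  fun h => `[< lspan [set boxtimes t.1 t.2 | t in [set: Lip0 x0 K^o * dual E]] h >].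

Record circledast :=
  MkCircledast { circledast_fun :> LipTensor -> K^o;
                 _ : circledast_fun \in circledast_pred }.

HB.instance Definition _ := [isSub for circledast_fun].
HB.instance Definition _ := [Choice of circledast by <:].
HB.instance Definition _ := GRing.isSubmodClosed.Build K
  (LipTensor -> K^o) circledast_pred (@lspan_submod_closed _ _ _).
HB.instance Definition _ := [SubChoice_isSubLmodule of circledast by <:].

Fact box_subproof g phi : boxtimes g phi \in circledast_pred.
Proof. by apply/asboolP/lspan_sub; exists (g, phi). Qed.

Definition box g phi : circledast := MkCircledast (box_subproof g phi).

Definition pi'_norm (h : circledast) : R :=
  sup_norm_on [set u | pi_norm u <= 1] h.

Lemma pi_norm_ge0 u : 0 <= pi_norm u.
Proof.
apply: lb_le_inf; first by have [s su] := represents_ex u; eexists; exists s.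
move=> _ [s _ <-]; apply: sumr_ge0 => t _.
by rewrite mulr_ge0 ?mdist_ge0 ?nrm_ge0.
Qed.

Lemma pi_norm_le s u : represents s u ->
  pi_norm u <= \sum_(t <- s) mdist t.1.1 t.1.2 * nrm t.2.
Proof.
move=> su; apply: ge_inf; last by exists s.
exists 0 => _ [s' _ <-]; apply: sumr_ge0 => t _.
by rewrite mulr_ge0 ?mdist_ge0 ?nrm_ge0.
Qed.

Lemma pi_normZ_le (a : K) u : pi_norm (a *: u) <= nrm (a : K^o) * pi_norm u.
Proof.
have [a0|a0] := eqVneq (nrm (a : K^o)) 0.
  have [s su] := represents_ex u.
  rewrite a0 mul0r (le_trans (pi_norm_le (representsZ a su)))// big_map big1//.
  by move=> t _ /=; rewrite nrmZ a0 mul0r mulr0.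
have an : 0 < nrm (a : K^o) by rewrite lt_neqAle eq_sym a0 nrm_ge0.
rewrite -ler_pdivrMl//; apply: lb_le_inf.
  by have [s su] := represents_ex u; eexists; exists s.
move=> _ [s su <-]; rewrite ler_pdivrMl// mulr_sumr.
rewrite (le_trans (pi_norm_le (representsZ a su)))// big_map ler_sum// => t _.
by rewrite nrmZ mulrCA.
Qed.

Lemma LipTensor_le (u : LipTensor) f : nrm (u f) <= Lip f * pi_norm u.
Proof.
have uf s : represents s u ->
    nrm (u f) <= Lip f * \sum_(t <- s) mdist t.1.1 t.1.2 * nrm t.2.
  move=> su; rewrite (representsE _ su) (le_trans (nrm_sum _ _))// mulr_sumr.
  apply: ler_sum => t _; rewrite (le_trans (dual_norm_le _ _))//.
  by rewrite mulrA ler_wpM2r ?nrm_ge0// -nrm_dual LipP.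
have [f0|f0] := eqVneq (Lip f) 0.
  by have [s /uf] := represents_ex u; rewrite f0 !mul0r.
have fn : 0 < Lip f by rewrite lt_neqAle eq_sym f0 Lip_ge0.
rewrite -ler_pdivrMl//; apply: lb_le_inf.
  by have [s su] := represents_ex u; eexists; exists s.
by move=> _ [s su <-]; rewrite ler_pdivrMl// uf.
Qed.

Lemma circledast_eval (h : circledast) :
  exists f : Lip0 x0 (dual E), forall u : LipTensor, h u = u f.
Proof.
have /asboolP := valP h.
pose W := [set h : LipTensor -> K^o | exists f, forall u : LipTensor, h u = u f].
suff : lspan [set boxtimes t.1 t.2 | t in [set: Lip0 x0 K^o * dual E]] `<=` W by exact.
apply: lspan_min; last first.
  by move=> _ [[g phi] _ <-]; exists (Lip0_dot g phi) => u; exact: boxtimes_eval.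
split.
  exists 0 => u; have := LipTensor_linear u (-1) 0 0.
  by rewrite scaleN1r addNr => ->; rewrite scaleN1r addNr.
move=> a v w [f vf] [g wg]; exists (a *: f + g) => u.
by rewrite LipTensor_linear !fctE vf wg.
Qed.

Let ball0 : [set u | pi_norm u <= 1] 0.
Proof.
rewrite /= (le_trans (pi_norm_le (s := [::]) _)) ?big_nil//.
by rewrite /represents big_nil.
Qed.

Lemma circledast_bounded (h : circledast) :
  exists M, forall u, [set u | pi_norm u <= 1] u -> nrm (h u) <= M.
Proof.
have [f hf] := circledast_eval h; exists (Lip f) => u /= u1.
by rewrite hf (le_trans (LipTensor_le _ _))// -[leRHS]mulr1 ler_wpM2l ?Lip_ge0.
Qed.

Lemma pi'_norm_ge0 h : 0 <= pi'_norm h.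
Proof. exact/(sup_norm_on_ge0 ball0)/circledast_bounded. Qed.

Lemma pi'_normD h k : pi'_norm (h + k) <= pi'_norm h + pi'_norm k.
Proof. by apply: (sup_norm_onD ball0); exact: circledast_bounded. Qed.

Lemma pi'_normZ (a : K) h : pi'_norm (a *: h) = nrm (a : K^o) * pi'_norm h.
Proof.
apply: seminormZ; first exact: pi'_norm_ge0.
by move=> c k; apply: (sup_norm_onZ_le ball0); exact: circledast_bounded.
Qed.

Lemma pi'_norm_eq0 h : pi'_norm h = 0 -> h = 0.
Proof.
move=> h0; apply: val_inj; apply/funext => u; apply: nrm_eq0.
have [f hf] := circledast_eval h.
pose r := (1 + pi_norm u)^-1.
have r0 : 0 < r by rewrite invr_gt0 ltr_pwDl// pi_norm_ge0.
have : nrm (h (of_real b r *: u)) <= 0.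
  rewrite -h0; apply: sup_norm_on_ub; first exact: circledast_bounded.
  rewrite /= (le_trans (pi_normZ_le _ _))// nrm_of_real ?(ltW r0)//.
  by rewrite mulrC ler_pdivrMr ?mul1r ?lerDr// ltr_pwDl// pi_norm_ge0.
rewrite !hf -[_ f]/(\val _ f) linearZ/= !fctE nrmZ nrm_of_real ?(ltW r0)//.
rewrite pmulr_rle0// => uf; apply/eqP; rewrite eq_le nrm_ge0 andbT.
by rewrite -[\val h u]/(h u) hf.
Qed.

HB.instance Definition _ := Lmodule_isNormed.Build K circledast
  (scalar_normD pi'_normD) (scalar_normZ pi'_normZ)
  (scalar_norm_eq0 pi'_norm_eq0).

Lemma nrm_circledast (h : circledast) : nrm h = pi'_norm h.
Proof. exact: of_realK. Qed.

End LipschitzTensor.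

Section LipschitzSubspaces.
Context {R : realType} {b : base_field}.
Local Notation K := (scalars R b).
Context {X : metricType R}.
Variables (x0 : X) (F : normedModType K).

Definition finite_rank (f : Lip0 x0 F) := finite_dimensional (lspan (range f)).

Definition Lip_approximable (f : Lip0 x0 F) :=
  exists fn : nat -> Lip0 x0 F,
    (forall n, finite_rank (fn n)) /\ fn n @[n --> \oo] --> f.

Lemma finite_rank0 : finite_rank 0.
Proof.
apply: (@finite_dimensional_sub _ _ 0 (fun=> 0)); first exact: subspace_lspan.
apply: lspan_min; first exact: subspace_lspan.
by move=> _ [x _ <-]; exact: lspan0.
Qed.

Lemma finite_rankP (a : K) f g :
  finite_rank f -> finite_rank g -> finite_rank (a *: f + g).
Proof.
move=> [n [v fv]] [m [w gw]].
pose z (i : 'I_(n + m)) :=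
  match fintype.split i with inl j => v j | inr j => w j end.
apply: (finite_dimensional_sub (w := z)); first exact: subspace_lspan.
apply: lspan_min; first exact: subspace_lspan.
move=> _ [x _ <-]; apply: lspanP.
  have : lspan (range f) (f x) by apply: lspan_sub; exists x.
  rewrite fv; apply: lspan_mono => _ [i _ <-]; exists (lshift m i) => //.
  by rewrite /z -[lshift m i]/(unsplit (inl i)) unsplitK.
have : lspan (range g) (g x) by apply: lspan_sub; exists x.
rewrite gw; apply: lspan_mono => _ [i _ <-]; exists (rshift n i) => //.
by rewrite /z -[rshift n i]/(unsplit (inr i)) unsplitK.
Qed.

Definition Lip0F_pred : {pred Lip0 x0 F} := fun f => `[< finite_rank f >].

Record Lip0F := MkLip0F { Lip0F_val :> Lip0 x0 F; _ : Lip0F_val \in Lip0F_pred }.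

HB.instance Definition _ := [isSub for Lip0F_val].
HB.instance Definition _ := [Choice of Lip0F by <:].

Fact Lip0F_submod_closed : submod_closed Lip0F_pred.
Proof.
split; first exact/asboolP/finite_rank0.
by move=> a f g /asboolP fF /asboolP gF; apply/asboolP/finite_rankP.
Qed.

HB.instance Definition _ :=
  GRing.isSubmodClosed.Build K (Lip0 x0 F) Lip0F_pred Lip0F_submod_closed.
HB.instance Definition _ := [SubChoice_isSubLmodule of Lip0F by <:].

Definition Lip_approx_pred : {pred Lip0 x0 F} := fun f => `[< Lip_approximable f >].

Record Lip_approx :=
  MkLip_approx { Lip_approx_val :> Lip0 x0 F; _ : Lip_approx_val \in Lip_approx_pred }.

HB.instance Definition _ := [isSub for Lip_approx_val].
HB.instance Definition _ := [Choice of Lip_approx by <:].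

Fact Lip_approx_submod_closed : submod_closed Lip_approx_pred.
Proof.
split.
  apply/asboolP; exists (fun=> 0); split; last exact: cvg_cst.
  by move=> _; exact: finite_rank0.
move=> a f g /asboolP[fn [fnF fnf]] /asboolP[gn [gnF gng]]; apply/asboolP.
exists (fun n => a *: fn n + gn n); split; first by move=> n; exact: finite_rankP.
by apply: cvgD => //; exact: cvgZr.
Qed.

HB.instance Definition _ := GRing.isSubmodClosed.Build K
  (Lip0 x0 F) Lip_approx_pred Lip_approx_submod_closed.
HB.instance Definition _ := [SubChoice_isSubLmodule of Lip_approx by <:].

Section SubNorm.
Context {p : {pred Lip0 x0 F}} {W : subLmodType p}.

Lemma sub_normD (v w : W) : `|\val (v + w)| <= `|\val v| + `|\val w|.
Proof. by rewrite linearD ler_normD. Qed.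

Lemma sub_normZ (a : K) (v : W) : `|\val (a *: v)| = `|a| * `|\val v|.
Proof. by rewrite linearZ/= normrZ. Qed.

Lemma sub_norm_eq0 (v : W) : `|\val v| = 0 -> v = 0.
Proof. by move/normr0_eq0 => v0; apply: val_inj; rewrite v0 linear0. Qed.

End SubNorm.

HB.instance Definition _ := @Lmodule_isNormed.Build K Lip0F
  (fun f => `|\val f|) sub_normD sub_normZ sub_norm_eq0.
HB.instance Definition _ := @Lmodule_isNormed.Build K Lip_approx
  (fun f => `|\val f|) sub_normD sub_normZ sub_norm_eq0.

Lemma nrm_Lip0F (f : Lip0F) : nrm f = Lip f.
Proof. exact: nrm_Lip0. Qed.

Lemma nrm_Lip_approx (f : Lip_approx) : nrm f = Lip f.
Proof. exact: nrm_Lip0. Qed.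

End LipschitzSubspaces.

Definition isometric_isomorphism (K : numFieldType) (V W : normedModType K)
  (f : {linear V -> W}) := bijective f /\ forall v, `|f v| = `|v|.

(* The completion is only determined up to isometric isomorphism: it is any
   Banach space with a dense isometric copy of V. *)
Definition is_completion (K : numFieldType) (V : normedModType K)
  (Z : completeNormedModType K) (j : {linear V -> Z}) :=
  (forall v, `|j v| = `|v|) /\ dense (range j).

(* Main.v *)
Require Import Defs.
From HB Require Import structures.
From mathcomp Require Import all_boot all_order all_algebra.
From mathcomp Require Import all_classical all_reals all_analysis.
From mathcomp Require Import complex.
Import Order.TTheory GRing.Theory Num.Theory.
Import numFieldNormedType.Exports.

Set Implicit Arguments.
Unset Strict Implicit.
Unset Printing Implicit Defensive.

Local Open Scope classical_set_scope.
Local Open Scope ring_scope.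

(** Write E' for the dual of E and X^# @ E' for the span of the functionals
    g [x] phi.  Each of them is the evaluation u |-> u f at exactly one f in
    Lip_0(X, E'), its symbol: for g [x] phi the symbol is g . phi, and the
    symbols of functionals are stable under linear combinations.  So K is the
    passage from a functional to its symbol: uniqueness of the symbol makes K
    independent of the representation, and linear (symbol_ex, symbol_uniq).

    K is isometric.  On one side |u f| <= Lip(f) pi(u); on the other the tensor
    delta_(x,y) [x] e / d(x,y) has norm pi at most 1 when |e| <= 1, and
    evaluating at f recovers the difference quotients of f (nrm_symbol).

    K is onto.  Suppose that f takes its values in the span of w_1, ..., w_n in
    E'.  If w_n is nonzero, pick e in E with w_n(e) = 1; then x |-> f(x)(e) is
    Lipschitz, and subtracting (x |-> f(x)(e)) . w_n leaves a map with values in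
    the span of the n-1 functionals w_i - w_i(e) w_n.  Induction on n writes f
    as a finite sum of g_j . phi_j (finite_rank_has_symbol).  The g_j are
    Lipschitz because they are built from evaluations of f at points of E.

    For the completion: a limit of finite-rank maps is exactly a point of
    Lip_0(X, E') in the closure of the image of K.  The approximable maps form
    a closed subspace of the Banach space Lip_0(X, E'), hence a Banach space in
    which K embeds X^# @ E' isometrically with dense range; and two
    completions of a normed space are isometrically isomorphic
    (completion_unique).

    Completeness is handled through regular families instead of filters or
    sequences: a family (u_i) with errors r_i, inf r_i = 0, such that
    |u_i - u_j| <= r_i + r_j.  In a Banach space such a family has a limit l with
    |u_i - l| <= r_i, the same errors.  Since the index type is arbitrary, points of a dense subspace
    can be indexed by themselves, with their distance to the target as error. *)

(** * Regular families and completeness *)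

Section Approximation.
Context {R : realType} {I : Type}.

Definition vanishing (r : I -> R) := forall eps, 0 < eps -> exists i, r i < eps.

Lemma le_vanishing (r : I -> R) (c x y : R) : vanishing r -> 0 <= c ->
  (forall i, x <= y + c * r i) -> x <= y.
Proof.
move=> vr c0 xy; apply/ler_addgt0Pr => eps eps0.
have c1 : 0 < c + 1 by rewrite ltr_wpDl.
have [i ri] := vr _ (divr_gt0 eps0 c1).
rewrite (le_trans (xy i))// lerD2l.
have [r0|r0] := leP 0 (r i); last first.
  by rewrite (le_trans _ (ltW eps0))// mulr_ge0_le0// ltW.
by rewrite (@le_trans _ _ ((c + 1) * r i)) ?ler_wpM2r ?lerDl// mulrC -ler_pdivlMr// ltW.
Qed.

Lemma vanishingM (r : I -> R) (c : R) : vanishing r -> 0 <= c ->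
  vanishing (fun i => r i * c).
Proof.
move=> vr c0 eps eps0; have c1 : 0 < c + 1 by rewrite ltr_wpDl.
have [i ri] := vr _ (divr_gt0 eps0 c1); exists i.
have [r0|r0] := leP 0 (r i); last first.
  by rewrite (le_lt_trans _ eps0)// mulr_le0_ge0// ltW.
by rewrite (@le_lt_trans _ _ (r i * (c + 1))) ?ler_wpM2l ?lerDl// -ltr_pdivlMr.
Qed.

End Approximation.

Section NormFacts.
Context {R : realType} {b : base_field}.
Local Notation K := (scalars R b).
Local Notation ofr := (@of_real R b).

Lemma ltr_of_real (x y : R) : (ofr x < ofr y) = (x < y).
Proof.
by rewrite !lt_def ler_of_real (inj_eq (can_inj (@of_realK R b))).
Qed.

Lemma of_real_gt0 (x : R) : (0 < ofr x) = (0 < x).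
Proof. by rewrite -(@of_real0 R b) ltr_of_real. Qed.

Lemma gt0_of_real (e : K) : 0 < e -> exists2 r : R, 0 < r & e = ofr r.
Proof.
move=> e0; exists (real_part e); last by rewrite real_partK// ltW.
by rewrite -of_real_gt0 real_partK// ltW.
Qed.

Context {V : normedModType K}.
Implicit Types v w : V.

Lemma nrm_distC v w : nrm (v - w) = nrm (w - v).
Proof. by rewrite -nrmN opprB. Qed.

Lemma nrm_distD u v w : nrm (v - w) <= nrm (v - u) + nrm (u - w).
Proof. by rewrite (le_trans _ (nrmD _ _))// addrA subrK. Qed.

Lemma nrm_ball v w (e : R) : ball v (ofr e) w = (nrm (v - w) < e) :> Prop.
Proof. by rewrite -ball_normE /ball_ /= -ltr_of_real nrmK. Qed.

End NormFacts.

Section Completeness.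
Context {R : realType} {b : base_field}.
Local Notation K := (scalars R b).
Local Notation ofr := (@of_real R b).

Definition regular (V : normedModType K) (I : Type) (r : I -> R) (u : I -> V) :=
  vanishing r /\ forall i j, nrm (u i - u j) <= r i + r j.

Definition regular_complete (V : normedModType K) :=
  forall (I : Type) (r : I -> R) (u : I -> V), regular r u ->
  exists l, forall i, nrm (u i - l) <= r i.

(** A rate of convergence known up to a constant improves to the errors
    themselves, by comparing u i with u j for r j tending to 0. *)
Lemma regular_limit_le (V : normedModType K) (I : Type) (r : I -> R) (u : I -> V)
    (l : V) (c : R) : regular r u -> 0 <= c ->
  (forall i, nrm (u i - l) <= c * r i) -> forall i, nrm (u i - l) <= r i.
Proof.
move=> [vr ru] c0 ul i; apply: (@le_vanishing _ _ r (1 + c)) => //.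
  by rewrite addr_ge0.
move=> j; rewrite (le_trans (nrm_distD (u j) _ _))//.
by rewrite mulrDl mul1r addrA lerD.
Qed.

(** A Cauchy filter contains, for each e > 0, a set of diameter at most e; points
    chosen in these sets form a regular family indexed by the positive reals,
    since two sets of the filter meet. *)
Lemma regular_completeP (V : normedModType K) : regular_complete V ->
  forall F : set_system V, ProperFilter F -> cauchy F -> cvg F.
Proof.
move=> cV F FF /cauchy_ballP Fc.
have small (e : {posnum R}) :
    exists2 A, F A & forall v w, A v -> A w -> nrm (v - w) < e%:num.
  have e0 : 0 < ofr e%:num by rewrite of_real_gt0.
  have [[A B] [/= FA FB] AB] := Fc _ e0.
  exists (A `&` B); first exact: filterI.
  by move=> v w [Av _] [_ Bw]; rewrite -(@nrm_ball R b); exact: (AB (v, w)).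
pose A e := s2val (cid2 (small e)).
have FA e : F (A e) := s2valP (cid2 (small e)).
have Ad e := s2valP' (cid2 (small e)).
have Aex (e : {posnum R}) : exists v, A e v.
  by have [v Av] := filter_ex (FA e); exists v.
pose u e := projT1 (cid (Aex e)).
have Au e : A e (u e) := projT2 (cid (Aex e)).
have [|l ul] := cV {posnum R} (fun e => e%:num) u.
  split=> [e e0|d e].
    have h0 : 0 < e / 2 by rewrite divr_gt0.
    by exists (PosNum h0); rewrite /= ltr_pdivrMr// ltr_pMr// ltr1n.
  have [v [dv ev]] := filter_ex (filterI (FA d) (FA e)).
  by rewrite (le_trans (nrm_distD v _ _))// lerD// ltW//;
    [exact: (Ad d _ _ (Au d) dv) | exact: (Ad e _ _ ev (Au e))].
apply/cvg_ex; exists l; apply/fcvg_ballP => e /gt0_of_real[s s0 ->].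
have h0 : 0 < s / 2 by rewrite divr_gt0.
pose h := PosNum h0.
near=> v; rewrite nrm_ball (le_lt_trans (nrm_distD (u h) _ _))//.
rewrite [ltRHS]splitr ler_ltD//; first by rewrite nrm_distC (ul h).
apply: (Ad h _ _ (Au h)); near: v; exact: (FA h).
Unshelve. all: by end_near. Qed.

(** The tails {u j | r j <= r i} generate a Cauchy filter. *)
Lemma complete_regular (V : completeNormedModType K) : regular_complete V.
Proof.
move=> I r u [vr ru].
have [i0 _] := vr 1 ltr01.
pose tail i := [set j | r j <= r i].
pose F := filter_from [set: I] (fun i => u @` tail i).
have FF : ProperFilter F.
  apply: filter_from_proper; last by move=> i _; exists (u i), i => //=; rewrite /tail /=.
  apply: filter_from_filter; first by exists i0.
  move=> i j _ _; wlog rij : i j / r i <= r j => [ij|].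
    by have [/ij//|/ltW/ij] := leP (r i) (r j); rewrite setIC.
  exists i => // _ [k /= ki <-]; split; exists k => //=.
  exact: le_trans rij.
have Fc : cauchy F.
  apply/cauchy_ballP => e /gt0_of_real[s s0 ->].
  have [i ri] : exists i, r i < s / 2 by apply: vr; rewrite divr_gt0.
  exists (u @` tail i, u @` tail i); first by split; exists i.
  move=> [_ _] [[j /= ji <-] [k /= ki <-]].
  by rewrite /= nrm_ball (le_lt_trans (ru _ _))// [ltRHS]splitr (le_lt_trans (lerD ji ki))// ltrD.
have Fl : F --> lim F := cauchy_cvg F Fc.
exists (lim F) => i; apply/ler_addgt0Pr => e e0.
have e20 : 0 < e / 2 by rewrite divr_gt0.
have /Fl[j _ jl] : nbhs (lim F) (ball (lim F) (ofr (e / 2))).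
  by apply: nbhsx_ballx; rewrite of_real_gt0.
(* Of j and an index of error below e / 2, the one with the smaller error. *)
have [k [kj ke]] : exists k, r k <= r j /\ r k < e / 2.
  have [k rk] := vr _ e20.
  by have [kj|/ltW jk] := leP (r k) (r j); [exists k | exists j; rewrite (le_lt_trans jk)].
have {}jl : nrm (u k - lim F) < e / 2.
  by rewrite nrm_distC -(@nrm_ball R b); apply: jl; exists k.
rewrite (le_trans (nrm_distD (u k) _ _))//.
rewrite (le_trans (lerD (ru i k) (ltW jl)))// -addrA lerD2l [leRHS]splitr lerD2r.
exact: ltW.
Qed.

End Completeness.
(** * Completeness of the spaces of functionals and of Lipschitz maps *)

Lemma subr_interchange (V : zmodType) (x y z t : V) :
  (x - y) - (z - t) = (x - z) - (y - t).
Proof. by rewrite !opprD addrACA. Qed.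

(** The intervals [u i - r i, u i + r i] meet pairwise, so the supremum of their
    left ends lies in all of them. *)
Lemma real_regular_complete (R : realType) (I : Type) (r : I -> R) (u : I -> R) :
  vanishing r -> (forall i j, `|u i - u j| <= r i + r j) ->
  exists l, forall i, `|u i - l| <= r i.
Proof.
move=> vr ru; have [i0 _] := vr 1 ltr01.
have ur i j : u i - r i <= u j + r j.
  by rewrite lerBlDr -addrA (addrC (r j)) -lerBlDl (le_trans (ler_norm _)).
pose S := range (fun i => u i - r i).
have Sub j : ubound S (u j + r j) by move=> _ [i _ <-].
exists (sup S) => i; rewrite ler_distlC; apply/andP; split.
  by apply: ub_le_sup; [exists (u i0 + r i0) | exists i].
by apply: ge_sup; first by exists (u i0 - r i0), i0.
Qed.

Section CompleteSpaces.
Context {R : realType} {b : base_field}.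
Local Notation K := (scalars R b).
Local Notation ofr := (@of_real R b).

(** In the complex case the real and imaginary parts are regular with the same
    errors, and the modulus of the difference is at most sqrt 2 r_i <= 2 r_i. *)
Lemma scalars_regular_complete : regular_complete (K^o : normedModType K).
Proof.
case: b => I r u [vr ru]; first exact: real_regular_complete.
have nE (z : R[i]) : @nrm R complex_base ((scalars R complex_base)^o) z
    = Num.sqrt (complex.Re z ^+ 2 + complex.Im z ^+ 2).
  exact: (congr1 (@complex.Re R) (normc_def z)).
have nRe (z : R[i]) : `|complex.Re z| <= Num.sqrt (complex.Re z ^+ 2 + complex.Im z ^+ 2).
  by rewrite -sqrtr_sqr ler_sqrt ?lerDl ?sqr_ge0// addr_ge0 ?sqr_ge0.
have nIm (z : R[i]) : `|complex.Im z| <= Num.sqrt (complex.Re z ^+ 2 + complex.Im z ^+ 2).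
  by rewrite -sqrtr_sqr ler_sqrt ?lerDr ?sqr_ge0// addr_ge0 ?sqr_ge0.
have [|x ux] := @real_regular_complete R I r (fun i => complex.Re (u i)) vr.
  move=> i j; rewrite (le_trans _ (ru i j))// nE (le_trans _ (nRe _))//.
  by case: (u i) (u j) => ? ? [].
have [|y uy] := @real_regular_complete R I r (fun i => complex.Im (u i)) vr.
  move=> i j; rewrite (le_trans _ (ru i j))// nE (le_trans _ (nIm _))//.
  by case: (u i) (u j) => ? ? [].
exists (x +i* y)%C.
apply: (@regular_limit_le R complex_base _ I r u _ 2) => // i.
rewrite nE; move: (ux i) (uy i); case: (u i) => /= c d xc yd.
have r0 : 0 <= r i by apply: le_trans xc.
rewrite -[leRHS]ger0_norm ?mulr_ge0// -sqrtr_sqr ler_sqrt ?sqr_ge0//.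
rewrite -[(c - x) ^+ 2]real_normK ?num_real// -[(d - y) ^+ 2]real_normK ?num_real//.
rewrite (@le_trans _ _ (r i ^+ 2 + r i ^+ 2))// ?lerD// ?ler_pXn2r ?nnegrE//.
by rewrite -mulr2n exprMn -[leLHS]mulr_natl ler_wpM2r ?sqr_ge0// -natrX ler_nat.
Qed.

Lemma bounded_linear_dual (E : normedModType K) (phi : {linear E -> K^o}) (M : R) :
  (forall e, nrm (phi e) <= M * nrm e) -> (phi : E -> K^o) \in @dual_pred R b E.
Proof.
move=> phiM; apply/asboolP; split; first by move=> a x y; rewrite linearP.
apply: bounded_linear_continuous; apply/linear_boundedP.
exists (ofr M); split.
  by have [M0|/ltW M0] := leP 0 M; [apply: ger0_real | apply: ler0_real];
    rewrite -(@of_real0 R b) ler_of_real.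
move=> c Mc e; rewrite (@le_trans _ _ (ofr M * `|e|)) ?ler_wpM2r ?(ltW Mc)//.
by rewrite -[`|phi e|](nrmK (phi e : K^o)) -nrmK -of_realM ler_of_real.
Qed.

(** The limit is taken pointwise: at e the values form a regular family with
    errors r i * |e|, which bounds the limit as a functional and gives back the
    rate r i in the dual norm. *)
Lemma dual_regular_complete (E : normedModType K) : regular_complete (dual E).
Proof.
move=> I r u [vr ru].
have ue e : regular (fun i => r i * nrm e) (fun i => u i e : K^o).
  split=> [|i j]; first exact/vanishingM/nrm_ge0.
  rewrite -mulrDl (@le_trans _ _ (nrm (u i - u j) * nrm e)) ?ler_wpM2r ?nrm_ge0//.
  by rewrite nrm_dual; exact: (dual_norm_le (u i - u j) e).
pose l e := projT1 (cid (scalars_regular_complete (ue e))).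
have ul e : forall i, nrm (u i e - l e) <= r i * nrm e :=
  projT2 (cid (scalars_regular_complete (ue e))).
have lin : linear (l : E -> K^o).
  move=> a x y; apply/eqP; rewrite -subr_eq0; apply/eqP/nrm_eq0/eqP.
  rewrite eq_le nrm_ge0 andbT.
  apply: (@le_vanishing _ _ r (nrm (a *: x + y) + (nrm (a : K^o) * nrm x + nrm y))) => //.
    by rewrite !addr_ge0 ?mulr_ge0 ?nrm_ge0.
  move=> i; rewrite add0r (le_trans (nrm_distD (u i (a *: x + y)) _ _))//.
  rewrite mulrDl lerD//; first by rewrite nrm_distC mulrC.
  rewrite linearP opprD addrACA -scalerBr (le_trans (nrmD _ _))// mulrDl lerD//.
    by rewrite nrmZ -mulrA ler_wpM2l ?nrm_ge0// [leRHS]mulrC; exact: ul.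
  by rewrite mulrC; exact: ul.
pose l' : {linear E -> K^o} := HB.pack l (GRing.isLinear.Build _ _ _ _ l lin).
have [i0 _] := vr 1 ltr01.
have lb e : nrm (l' e) <= (nrm (u i0) + r i0) * nrm e.
  have -> : l' e = u i0 e - (u i0 e - l e) by rewrite subKr.
  rewrite (le_trans (nrmD _ _))// nrmN mulrDl lerD//.
  by rewrite nrm_dual dual_norm_le.
exists (Dual (bounded_linear_dual lb)) => i.
rewrite nrm_dual; apply: (@sup_norm_on_le _ _ _ _ (0 : E)); first by rewrite /= nrm0.
have r0 : 0 <= r i.
  by have := le_trans (nrm_ge0 _) (ru i i); rewrite -mulr2n pmulrn_lge0.
by move=> e /= e1; rewrite (le_trans (ul e i))// -[leRHS]mulr1 ler_wpM2l.
Qed.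

Context {X : metricType R} (x0 : X).

(** The limit is taken pointwise with errors r i * d(x, x0).  Far from x0
    these are too large to bound the limit of f x - f y by a multiple of d(x, y);
    letting j vary in the estimate (r i + r j) * d(x, y) on u i - u j does it. *)
Lemma Lip0_regular_complete (F : normedModType K) :
  regular_complete F -> regular_complete (Lip0 x0 F).
Proof.
move=> cF I r u [vr ru].
have uxy i j x y : nrm ((u i x - u i y) - (u j x - u j y)) <= (r i + r j) * mdist x y.
  rewrite (@le_trans _ _ (nrm (u i - u j) * mdist x y)) ?ler_wpM2r ?mdist_ge0//.
  have := LipP (u i - u j) x y; rewrite nrm_Lip0 /= !fctE.
  by rewrite subr_interchange.
have ux x : regular (fun i => r i * mdist x x0) (fun i => u i x).
  split=> [|i j]; first exact/vanishingM/mdist_ge0.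
  by have := uxy i j x x0; rewrite !Lip0_base !subr0 mulrDl.
pose l x := projT1 (cid (cF _ _ _ (ux x))).
have ul x : forall i, nrm (u i x - l x) <= r i * mdist x x0 :=
  projT2 (cid (cF _ _ _ (ux x))).
have ulxy i x y : nrm ((u i x - u i y) - (l x - l y)) <= r i * mdist x y.
  apply: (@le_vanishing _ _ r (mdist x y + (mdist x x0 + mdist y x0))) => //.
    by rewrite !addr_ge0 ?mdist_ge0.
  move=> j; rewrite (le_trans (nrm_distD (u j x - u j y) _ _))//.
  rewrite mulrDl addrA lerD//; first by rewrite [mdist x y * _]mulrC -mulrDl.
  rewrite subr_interchange (le_trans (nrmD _ _))//.
  by rewrite mulrDl lerD// ?nrmN mulrC.
have l0 : l x0 = 0.
  have [i0 _] := vr 1 ltr01; apply/eqP; rewrite -oppr_eq0 -sub0r; apply/eqP/nrm_eq0/eqP.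
  by rewrite eq_le nrm_ge0 andbT; have := ul x0 i0; rewrite Lip0_base mdistxx mulr0.
have lL : l \in @Lip0_pred R b X x0 F.
  have [i0 _] := vr 1 ltr01.
  apply/asboolP; split=> //; exists (Lip (u i0) + r i0) => x y.
  have -> : l x - l y = (u i0 x - u i0 y) - ((u i0 x - u i0 y) - (l x - l y)).
    by rewrite subKr.
  by rewrite (le_trans (nrmD _ _))// nrmN mulrDl lerD// LipP.
exists (MkLip0 lL) => i; rewrite nrm_Lip0; apply: Lip_le.
  by have := le_trans (nrm_ge0 _) (ru i i); rewrite -mulr2n pmulrn_lge0.
move=> x y; rewrite /= !fctE subr_interchange; exact: ulxy.
Qed.

(** Membership in the closure, in the form in which the density of the finite-rank
    maps and the closedness of the approximable ones use it. *)
Lemma Lip_approximableP (F : normedModType K) (f : Lip0 x0 F) :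
  Lip_approximable f <->
  forall e : R, 0 < e -> exists2 g, finite_rank g & nrm (f - g) < e.
Proof.
split=> [[fn [fnF fnf]] e e0|fP].
  have /fnf[n _ /(_ n (leqnn n)) fe] : nbhs f (ball f (ofr e)).
    by apply: nbhsx_ballx; rewrite of_real_gt0.
  by exists (fn n) => //; rewrite -(@nrm_ball R b).
have fP' n : exists2 g, finite_rank g & nrm (f - g) < n.+1%:R^-1.
  by apply: fP; rewrite invr_gt0.
exists (fun n => s2val (cid2 (fP' n))); split=> [n|]; first exact: (s2valP (cid2 (fP' n))).
apply/cvg_ballP => e /gt0_of_real[s s0 ->].
near=> n; rewrite nrm_ball (lt_trans (s2valP' (cid2 (fP' n))))//.
near: n; exact: near_infty_natSinv_lt (PosNum s0).
Unshelve. all: by end_near. Qed.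

Lemma Lip_approx_regular_complete (F : normedModType K) :
  regular_complete F -> regular_complete (Lip_approx x0 F).
Proof.
move=> cF I r u [vr ru].
have [|l ul] := Lip0_regular_complete cF (r := r) (u := fun i => Lip_approx_val (u i)).
  by split=> // i j; rewrite (le_trans _ (ru i j)).
have lA : l \in @Lip_approx_pred R b X x0 F.
  apply/asboolP/Lip_approximableP => e e0.
  have [i ri] : exists i, r i < e / 2 by apply: vr; rewrite divr_gt0.
  have /asboolP/Lip_approximableP/(_ (e / 2))[|g gF gu] := valP (u i).
    by rewrite divr_gt0.
  exists g => //; rewrite (le_lt_trans (nrm_distD (Lip_approx_val (u i)) _ _))//.
  by rewrite [ltRHS]splitr ler_ltD// nrm_distC (le_trans (ul i))// ltW.
exists (MkLip_approx lA) => i; rewrite nrm_Lip_approx -nrm_Lip0.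
by rewrite -[Lip_approx_val _]/(\val _) linearB; exact: ul.
Qed.

End CompleteSpaces.
(** * Uniqueness of the completion *)

Section CompletionUniqueness.
Context {R : realType} {b : base_field}.
Local Notation K := (scalars R b).
Context {V : normedModType K}.

Definition isometric_dense (A : normedModType K) (i : {linear V -> A}) :=
  (forall v, nrm (i v) = nrm v) /\
  forall a (e : R), 0 < e -> exists v, nrm (i v - a) < e.

Lemma is_completionP (Z : completeNormedModType K) (j : {linear V -> Z}) :
  is_completion j <-> isometric_dense j.
Proof.
split=> -[jn jd]; split=> [v|].
- by rewrite /nrm jn.
- move=> z e e0.
  have [||z' [/= zz' [v _ vz]]] := jd (interior (ball z (of_real b e))).
  + by exists z; apply: nbhsx_ballx; rewrite of_real_gt0.
  + exact: open_interior.
  exists v; move/interior_subset: zz'.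
  by rewrite nrm_ball nrm_distC vz.
- by rewrite -!nrmK jn.
- move=> O [z Oz] oO.
  have /nbhs_ballP[_ /= /gt0_of_real[e e0 ->] eO] := open_nbhs_nbhs (conj oO Oz).
  have [v vz] := jd z e e0; exists (j v); split; last by exists v.
  by apply: eO; rewrite nrm_ball nrm_distC.
Qed.

(** If i and j embed V densely and isometrically in the Banach spaces A and B,
    then this closure of the set of all (i v, j v) in A * B is the graph of the
    isomorphism from A to B. *)
Definition graph_closure (A B : normedModType K) (i : {linear V -> A})
    (j : {linear V -> B}) (x : A) (y : B) :=
  forall e : R, 0 < e -> exists v, nrm (i v - x) < e /\ nrm (j v - y) < e.

Lemma graph_closure_sym (A B : normedModType K) (i : {linear V -> A})
    (j : {linear V -> B}) x y : graph_closure i j x y -> graph_closure j i y x.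
Proof. by move=> xy e /xy[v []]; exists v. Qed.

Lemma graph_closure_le (A B : normedModType K) (i : {linear V -> A})
    (j : {linear V -> B}) x y : (forall v, nrm (i v) = nrm v) ->
  (forall v, nrm (j v) = nrm v) -> graph_closure i j x y -> nrm x <= nrm y.
Proof.
move=> ni nj xy; apply/ler_addgt0Pr => e e0.
have [v [vx vy]] : exists v, nrm (i v - x) < e / 2 /\ nrm (j v - y) < e / 2.
  by apply: xy; rewrite divr_gt0.
have jv : nrm (j v) <= nrm (j v - y) + nrm y by rewrite -{1}[j v](subrK y) nrmD.
rewrite -[x](subKr (i v)) (le_trans (nrmD _ _))// nrmN ni -nj (splitr e) addrA.
by rewrite lerD ?(ltW vx)// (le_trans jv)// [leLHS]addrC lerD2l ltW.
Qed.

Section Correspondence.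
Context {A B : normedModType K} {i : {linear V -> A}} {j : {linear V -> B}}.
Hypotheses (iA : isometric_dense i) (jB : isometric_dense j).
Local Notation related := (graph_closure i j).

(** The family j, indexed by V itself with errors |i v - a|, is regular because i
    and j induce the same distance on V; its limit is the point of B that
    corresponds to a. *)
Lemma graph_closure_ex (a : A) : regular_complete B -> exists y, related a y.
Proof.
move=> /(_ V (fun v => nrm (i v - a)) j)[|y jy].
  split=> [e|v w]; first exact: iA.2.
  rewrite -linearB jB.1 -iA.1 linearB (le_trans (nrm_distD a _ _))// lerD//.
  by rewrite nrm_distC.
exists y => e /(iA.2 a)[v va]; exists v; split=> //.
exact: le_lt_trans va.
Qed.

Lemma graph_closureP (c : K) a a' y y' :
  related a y -> related a' y' -> related (c *: a + a') (c *: y + y').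
Proof.
move=> ay ay' e e0; have e20 : 0 < e / 2 by rewrite divr_gt0.
have c0 : 0 < nrm (c : K^o) + 1 by rewrite ltr_wpDl// nrm_ge0.
have [v [va vy]] := ay _ (divr_gt0 e20 c0).
have [w [wa wy]] := ay' _ e20.
have comb (C : normedModType K) (k : {linear V -> C}) t t' :
    nrm (k v - t) < e / 2 / (nrm (c : K^o) + 1) -> nrm (k w - t') < e / 2 ->
    nrm (k (c *: v + w) - (c *: t + t')) < e.
  move=> vt wt; rewrite linearP opprD addrACA -scalerBr (le_lt_trans (nrmD _ _))//.
  rewrite [ltRHS]splitr ler_ltD// nrmZ.
  rewrite (@le_trans _ _ ((nrm (c : K^o) + 1) * nrm (k v - t))) ?ler_wpM2r ?nrm_ge0 ?lerDl//.
  by rewrite mulrC -ler_pdivlMr// ltW.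
by exists (c *: v + w); split; exact: comb.
Qed.

Lemma graph_closure_nrm a y : related a y -> nrm a = nrm y.
Proof.
move=> ay; apply/le_anti; rewrite (graph_closure_le iA.1 jB.1 ay).
exact: graph_closure_le jB.1 iA.1 (graph_closure_sym ay).
Qed.

Lemma graph_closure_uniq a y z : related a y -> related a z -> y = z.
Proof.
move=> ay az; apply/eqP; rewrite -subr_eq0; apply/eqP/nrm_eq0.
have := graph_closureP (-1) az ay; rewrite !scaleN1r addNr => /graph_closure_nrm.
by rewrite nrm0 addrC.
Qed.

End Correspondence.

(** The relation is total, single-valued, linear and isometric, and it is
    symmetric in the two embeddings, which gives the inverse. *)
Lemma completion_unique (A B : normedModType K) (i : {linear V -> A})
    (j : {linear V -> B}) : regular_complete A -> regular_complete B ->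
  isometric_dense i -> isometric_dense j ->
  exists f : {linear A -> B}, isometric_isomorphism f.
Proof.
move=> cA cB iA jB.
pose f a := projT1 (cid (graph_closure_ex iA jB a cB)).
have fP a : graph_closure i j a (f a) := projT2 (cid (graph_closure_ex iA jB a cB)).
pose g y := projT1 (cid (graph_closure_ex jB iA y cA)).
have gP y : graph_closure j i y (g y) := projT2 (cid (graph_closure_ex jB iA y cA)).
have flin : linear f.
  by move=> c a a'; apply: (graph_closure_uniq iA jB (fP _)); exact: graph_closureP.
exists (HB.pack f (GRing.isLinear.Build _ _ _ _ f flin) : {linear A -> B}); split.
  exists g => [a|y] /=.
    exact: (graph_closure_uniq jB iA (gP (f a)) (graph_closure_sym (fP a))).
  exact: (graph_closure_uniq iA jB (fP (g y)) (graph_closure_sym (gP y))).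
by move=> a /=; rewrite -!nrmK (graph_closure_nrm iA jB (fP a)).
Qed.

End CompletionUniqueness.
(** * The symbol of a functional *)

Lemma lspan_image (K : fieldType) (V W : lmodType K) (P : {linear V -> W})
    (A : set V) (B : set W) :
  (forall v, A v -> lspan B (P v)) -> forall v, lspan A v -> lspan B (P v).
Proof.
move=> AB; apply: lspan_min => //; split; first by rewrite linear0; exact: lspan0.
by move=> a v w; rewrite linearP; exact: lspanP.
Qed.

Section Symbol.
Context {R : realType} {b : base_field}.
Local Notation K := (scalars R b).
Local Notation ofr := (@of_real R b).
Context {X : metricType R} (x0 : X) (E : normedModType K).

Fact elementary_subproof (x y : X) (e : E) : delta_box x y e \in @LipTensor_pred R b X x0 E.
Proof. by apply/asboolP/lspan_sub; exists (x, y, e). Qed.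

Definition elementary x y e : LipTensor x0 E := MkLipTensor (elementary_subproof x y e).

Lemma pi_norm_elementary x y e : pi_norm (elementary x y e) <= mdist x y * nrm e.
Proof.
have := @pi_norm_le R b X x0 E [:: (x, y, e)] (elementary x y e).
by rewrite /represents !big_seq1; exact.
Qed.

Definition has_symbol (h : circledast x0 E) (f : Lip0 x0 (dual E)) :=
  forall u : LipTensor x0 E, h u = u f.

(** The tensors delta_(x, x0) [x] e separate the maps that vanish at x0. *)
Lemma symbol_uniq h f g : has_symbol h f -> has_symbol h g -> f = g.
Proof.
move=> hf hg; apply: val_inj; apply/funext => x; apply: val_inj; apply/funext => e.
have := etrans (esym (hf (elementary x x0 e))) (hg (elementary x x0 e)).
by rewrite /= /delta_box !Lip0_base !subr0.
Qed.

Lemma has_symbolP (a : K) h k f g :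
  has_symbol h f -> has_symbol k g -> has_symbol (a *: h + k) (a *: f + g).
Proof. by move=> hf kg u; rewrite LipTensor_linear -hf -kg. Qed.

Lemma has_symbol0 : has_symbol 0 0.
Proof.
move=> u; have := LipTensor_linear u (-1) 0 0.
by rewrite scaleN1r addNr => ->; rewrite scaleN1r addNr.
Qed.

Lemma has_symbol_box g phi : has_symbol (box g phi) (Lip0_dot g phi).
Proof. by move=> u; exact: boxtimes_eval. Qed.

Lemma finite_rank_dot (g : Lip0 x0 K^o) (phi : dual E) : finite_rank (Lip0_dot g phi).
Proof.
apply: (@finite_dimensional_sub _ _ 1 (fun=> phi)); first exact: subspace_lspan.
apply: lspan_min; first exact: subspace_lspan.
move=> _ [x _ <-]; rewrite -[Lip0_dot g phi x]addr0; apply: lspanP; last exact: lspan0.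
by apply: lspan_sub; exists ord0.
Qed.

(** The functionals with a finite-rank symbol form a subspace that contains every
    g [x] phi. *)
Lemma symbol_ex (h : circledast x0 E) : exists2 f, finite_rank f & has_symbol h f.
Proof.
have /asboolP := valP h.
pose W := [set h : LipTensor x0 E -> K^o |
  exists2 f, finite_rank f & forall u : LipTensor x0 E, h u = u f].
suff : lspan [set boxtimes t.1 t.2 | t in [set: Lip0 x0 K^o * dual E]] `<=` W by exact.
apply: lspan_min; last first.
  move=> _ [[g phi] _ <-]; exists (Lip0_dot g phi); first exact: finite_rank_dot.
  exact: has_symbol_box.
split.
  by exists 0; [exact: finite_rank0|exact: has_symbol0].
move=> a v w [f Ff vf] [g Fg wg]; exists (a *: f + g); first exact: finite_rankP.
by move=> u; rewrite LipTensor_linear !fctE vf wg.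
Qed.

(** On the tensors delta_(x, y) [x] e / d(x, y) with |e| <= 1, which lie in the
    unit ball of pi, h takes as values the difference quotients of f applied to
    e; no other u in the ball gives more, by LipTensor_le. *)
Lemma nrm_symbol h f : has_symbol h f -> nrm h = nrm f.
Proof.
move=> hf; rewrite nrm_circledast nrm_Lip0; apply/le_anti/andP; split.
  apply: (@sup_norm_on_le _ _ _ _ (0 : LipTensor x0 E)).
    rewrite /= (le_trans (pi_norm_le (s := [::]) _)) ?big_nil//.
    by rewrite /represents big_nil.
  move=> u /= u1; rewrite hf (le_trans (LipTensor_le _ _))//.
  by rewrite -[leRHS]mulr1 ler_wpM2l ?Lip_ge0.
apply: Lip_le; first exact: pi'_norm_ge0.
move=> x y; have [->|xy] := eqVneq x y; first by rewrite subrr nrm0 mdistxx mulr0.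
have d0 : 0 < mdist x y by rewrite mdist_gt0.
rewrite nrm_dual; apply: (@sup_norm_on_le _ _ _ _ (0 : E)); first by rewrite /= nrm0.
move=> e /= e1; rewrite -ler_pdivrMr//.
have nV : nrm (ofr (mdist x y)^-1 : K^o) = (mdist x y)^-1.
  by rewrite nrm_of_real// invr_ge0 ltW.
rewrite mulrC -nV -nrmZ -linearZ.
rewrite -[_ (_ *: e)](hf (elementary x y (ofr (mdist x y)^-1 *: e))).
apply: sup_norm_on_ub; first exact: circledast_bounded.
rewrite /= (le_trans (pi_norm_elementary _ _ _))// nrmZ nV mulrA mulfV ?gt_eqF//.
by rewrite mul1r.
Qed.

Fact eval_subproof (f : Lip0 x0 (dual E)) (e : E) :
  (fun x => f x e) \in @Lip0_pred R b X x0 K^o.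
Proof.
apply/asboolP; split; first by rewrite Lip0_base.
exists (Lip f * nrm e) => x y.
rewrite (@le_trans _ _ (nrm (f x - f y) * nrm e))//.
  by rewrite nrm_dual; exact: (dual_norm_le (f x - f y) e).
by rewrite mulrAC ler_wpM2r ?nrm_ge0// LipP.
Qed.

Definition Lip0_eval f e : Lip0 x0 K^o := MkLip0 (eval_subproof f e).

(** Gaussian elimination on a family w that spans the values of f: the projection
    P q = q - q(e) p along the last functional p kills p when p(e) = 1, so that
    P o f takes its values in the span of one functional fewer, while f - P o f
    is the elementary map x |-> f(x)(e) p. *)
Lemma finite_rank_has_symbol f : finite_rank f -> exists h, has_symbol h f.
Proof.
move=> [n [w fw]].
have {}fw x : lspan (range w) (f x) by rewrite -fw; apply: lspan_sub; exists x.
elim: n w f fw => [|n IH] w f fw.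
  have w0 : lspan (range w) `<=` [set 0].
    apply: lspan_min; last by move=> v [[]].
    by split=> // a v z /= -> ->; rewrite scaler0 addr0.
  exists 0; have -> : f = 0 by apply: val_inj; apply/funext => x; exact/w0/fw.
  exact: has_symbol0.
pose p : dual E := w ord_max.
(* The case p = 0 is included, with P the identity. *)
have [e pe] : exists e, p - p e *: p = 0.
  have [p0|/existsNP[e pe]] := pselect (forall e, p e = 0).
    exists 0; rewrite p0 scale0r subr0; apply: val_inj; apply/funext => e.
    exact: p0.
  exists ((p e)^-1 *: e).
  have -> : p ((p e)^-1 *: e) = 1 by rewrite linearZ; exact/mulVf/eqP.
  by rewrite scale1r subrr.
pose P (q : dual E) : dual E := q - q e *: p.
have Plin : linear P.
  move=> a q q'; rewrite /P.
  have -> : (a *: q + q') e = a * q e + q' e by [].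
  by rewrite scalerDl opprD addrACA scalerBr scalerA.
pose P' : {linear dual E -> dual E} := HB.pack P (GRing.isLinear.Build _ _ _ _ P Plin).
pose w' (i : 'I_n) := P (w (widen_ord (leqnSn n) i)).
have [x|h hf] := IH w' (f - Lip0_dot (Lip0_eval f e) p).
  apply: (@lspan_image _ _ _ P' (range w) (range w') _ (f x)) => // _ [i _ <-].
  have [ni|ni] := ltnP i n.
    apply: lspan_sub; exists (Ordinal ni) => //.
    by rewrite /w'; congr (P (w _)); exact: val_inj.
  have -> : i = ord_max.
    by apply: val_inj; apply/eqP; rewrite eqn_leq ni -ltnS ltn_ord.
  by rewrite /= /P pe; exact: lspan0.
exists (1 *: box (Lip0_eval f e) p + h).
rewrite [X in has_symbol _ X](_ : f = 1 *: Lip0_dot (Lip0_eval f e) p + (f - Lip0_dot (Lip0_eval f e) p)).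
  exact: has_symbolP (has_symbol_box _ _) hf.
by rewrite scale1r addrC subrK.
Qed.

(** The map K of the theorem. *)
Definition symbol (h : circledast x0 E) : Lip0F x0 (dual E) :=
  MkLip0F (introT (asboolP _) (s2valP (cid2 (symbol_ex h)))).

Lemma symbolP h : has_symbol h (symbol h).
Proof. exact: (s2valP' (cid2 (symbol_ex h))). Qed.

Lemma symbol_linear : linear symbol.
Proof.
move=> a h k; apply: val_inj; rewrite linearP.
exact: symbol_uniq (symbolP _) (has_symbolP a (symbolP h) (symbolP k)).
Qed.

HB.instance Definition _ := GRing.isLinear.Build K (circledast x0 E)
  (Lip0F x0 (dual E)) *:%R symbol symbol_linear.

Lemma symbol_isometric_isomorphism : isometric_isomorphism symbol.
Proof.
have sn h : nrm (symbol h) = nrm h.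
  by rewrite nrm_Lip0F -nrm_Lip0 (nrm_symbol (symbolP h)).
have surj f : exists h, symbol h = f.
  have /asboolP/finite_rank_has_symbol[h hf] := valP f.
  by exists h; apply: val_inj; exact: symbol_uniq (symbolP h) hf.
have inj : injective symbol.
  move=> h k hk; apply/eqP; rewrite -subr_eq0; apply/eqP/nrm_eq0.
  by rewrite -sn linearB /= hk subrr nrm0.
split; last by move=> h; rewrite -!nrmK sn.
exists (fun f => projT1 (cid (surj f))) => [h|f]; last exact: projT2 (cid (surj f)).
exact/inj/(projT2 (cid (surj (symbol h)))).
Qed.

Lemma symbol_sum_box (m : nat) (g : 'I_m -> Lip0 x0 K^o) (phi : 'I_m -> dual E) :
  Lip0F_val (symbol (\sum_(j < m) box (g j) (phi j))) =
  \sum_(j < m) Lip0_dot (g j) (phi j).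
Proof.
apply: symbol_uniq (symbolP _) _.
elim/big_ind2: _ => [|h f k f' hf kf'|j _]; first exact: has_symbol0.
  by rewrite -[h]scale1r -[f]scale1r; exact: has_symbolP.
exact: has_symbol_box.
Qed.

Fact Lip0F_approx_subproof (f : Lip0F x0 (dual E)) :
  Lip0F_val f \in @Lip_approx_pred R b X x0 (dual E).
Proof.
case: f => f /= /asboolP Ff; apply/asboolP/Lip_approximableP => e e0.
by exists f => //; rewrite subrr nrm0.
Qed.

(** K followed by the inclusion in the approximable maps: the embedding that
    exhibits these as a completion. *)
Definition approx_symbol (h : circledast x0 E) : Lip_approx x0 (dual E) :=
  MkLip_approx (Lip0F_approx_subproof (symbol h)).

Lemma approx_symbol_linear : linear approx_symbol.
Proof.
move=> a h k; apply: val_inj; rewrite linearP /=.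
exact: (congr1 (@Lip0F_val _ _ _ _ _) (linearP symbol a h k)).
Qed.

HB.instance Definition _ := GRing.isLinear.Build K (circledast x0 E)
  (Lip_approx x0 (dual E)) *:%R approx_symbol approx_symbol_linear.

Lemma approx_symbol_isometric_dense : isometric_dense approx_symbol.
Proof.
split=> [h|f e e0].
  by rewrite (nrm_symbol (symbolP h)) nrm_Lip_approx nrm_Lip0.
have /asboolP/Lip_approximableP/(_ e e0)[g Fg fg] := valP f.
have [h hg] := finite_rank_has_symbol Fg; exists h.
rewrite nrm_distC nrm_Lip_approx -nrm_Lip0 -[Lip_approx_val _]/(\val _) linearB.
by rewrite -(symbol_uniq (symbolP h) hg) in fg.
Qed.

End Symbol.
(** * The approximable maps as a completion *)

HB.instance Definition _ (R : realType) (b : base_field) (X : metricType R) (x0 : X)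
    (E : normedModType (scalars R b)) :=
  Uniform_isComplete.Build (Lip_approx x0 (dual E))
    (@regular_completeP _ _ _ (Lip_approx_regular_complete (dual_regular_complete (E := E)))).

Theorem theorem8p1 (R : realType) (b : base_field) (X : metricType R) (x0 : X)
    (E : completeNormedModType (scalars R b)) :
  (exists Kmap : {linear circledast x0 E -> Lip0F x0 (dual E)},
     (forall (m : nat) (g : 'I_m -> Lip0 x0 (scalars R b)^o) (phi : 'I_m -> dual E),
        Lip0F_val (Kmap (\sum_(j < m) box (g j) (phi j))) =
        \sum_(j < m) Lip0_dot (g j) (phi j)) /\
     isometric_isomorphism Kmap) /\
  (exists (Z : completeNormedModType (scalars R b))
     (j : {linear circledast x0 E -> Z}), is_completion j) /\
  (forall (Z : completeNormedModType (scalars R b))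
     (j : {linear circledast x0 E -> Z}), is_completion j ->
   exists Psi : {linear Lip_approx x0 (dual E) -> Z}, isometric_isomorphism Psi).
Proof.
split; [|split].
- exists (@symbol R b X x0 E : {linear _ -> _}).
  by split; [exact: symbol_sum_box|exact: symbol_isometric_isomorphism].
- exists (Lip_approx x0 (dual E)), (@approx_symbol R b X x0 E).
  by apply/is_completionP; exact: approx_symbol_isometric_dense.
- move=> Z j /is_completionP jZ.
  apply: completion_unique jZ; last exact: approx_symbol_isometric_dense.
    exact/Lip_approx_regular_complete/dual_regular_complete.
  exact: complete_regular.
Qed.
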